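(* Let $\Omega\subseteq\mathbb{R}^n$ be a domain and let $\{B_i\}_{i=1}^N$ be a collection of $n$-balls contained in $\Omega$ that is unisolvent for $\mathbb{P}_d(\mathbb{R}^n)$, with Lagrange basis $\{\ell_{B_i}\}_{i=1}^N$ and associated interpolation operator $\Pi$. If $B_i\cap B_j=\emptyset$ for all $i\ne j$, then the Lebesgue constant $\Lambda_d:=\|\Pi\|_{\mathrm{op}}$ satisfies $$\Lambda_d=\sup_{B\in\mathcal{B}^n(\Omega)}\frac{1}{|B|}\sum_{i=1}^N |B_i|\left|\int_B \ell_{B_i}\right|.$$
   Context: $\mathbb{P}_d(\mathbb{R}^n)$ is the space of real polynomials in $n$ variables of total degree at most $d$, and $N=\dim\mathbb{P}_d(\mathbb{R}^n)$. An $n$-ball is a closed Euclidean ball of positive radius in $\mathbb{R}^n$; $|B|$ is its Lebesgue measure; integrals are with respect to Lebesgue measure. A collection of $n$-balls $\{B_i\}_{i=1}^N$ is unisolvent for $\mathbb{P}_d(\mathbb{R}^n)$ if the only $p\in\mathbb{P}_d(\mathbb{R}^n)$ with $\int_{B_i}p=0$ for all $i=1,\ldots,N$ is $p=0$. The Lagrange basis $\{\ell_{B_i}\}_{i=1}^N$ is then the unique basis of $\mathbb{P}_d(\mathbb{R}^n)$ with $\int_{B_j}\ell_{B_i}=\delta_{i,j}$, and the interpolation operator is $\Pi:C^0(\mathbb{R}^n)\to\mathbb{P}_d(\mathbb{R}^n)$, $\Pi f=\sum_{i=1}^N\left(\int_{B_i}f\right)\ell_{B_i}$. $\mathcal{B}^n(\Omega)$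 is the set of all $n$-balls contained in $\Omega$, and $\|f\|_B:=\sup_{B\in\mathcal{B}^n(\Omega)}\frac{1}{|B|}\left|\int_B f\right|$. The operator norm is $\|\Pi\|_{\mathrm{op}}=\sup\frac{\|\Pi f\|_B}{\|f\|_B}$, the supremum being over $f\in C^0(\mathbb{R}^n)$ with $0<\|f\|_B<\infty$. *)

(* Defs.v *)
From HB Require Import structures.
From mathcomp Require Import all_boot all_order all_algebra.
From mathcomp Require Import -(notations) mpoly.
From mathcomp Require Import all_classical all_reals all_analysis.

Set Implicit Arguments.
Unset Strict Implicit.
Unset Printing Implicit Defensive.

Import Order.TTheory GRing.Theory Num.Theory.
Import numFieldNormedType.Exports.

Local Open Scope classical_set_scope.
Local Open Scope ring_scope.

Definition measure_row_display : measure_display -> measure_display.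
Proof. exact. Qed.

Section measurable_row.
Context {d} {T : measurableType d}.
Variable n : nat.

Let coors : 'I_n -> 'rV[T]_n -> T := fun i x => x ord0 i.

Let row_set0 : g_sigma_preimage coors set0.
Proof. exact: sigma_algebra0. Qed.

Let row_setC A : g_sigma_preimage coors A -> g_sigma_preimage coors (~` A).
Proof. exact: sigma_algebraC. Qed.

Let row_bigcup (F : _^nat) : (forall i, g_sigma_preimage coors (F i)) ->
  g_sigma_preimage coors (\bigcup_i (F i)).
Proof. exact: sigma_algebra_bigcup. Qed.

(* The product sigma-algebra, generated by the coordinates; for T = R it is the
   Borel sigma-algebra of R^n. *)
HB.instance Definition _ := @isMeasurable.Build (measure_row_display d)
  'rV[T]_n (g_sigma_preimage coors) row_set0 row_setC row_bigcup.

End measurable_row.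

Lemma measurable_coor d (T : measurableType d) n (i : 'I_n) :
  measurable_fun [set: 'rV[T]_n] (fun x : 'rV[T]_n => x ord0 i).
Proof.
move=> _ Y mY; rewrite setTI; apply: sub_sigma_algebra => /=.
rewrite -bigcup_seq/=; exists i => /=; first by rewrite mem_index_enum.
by exists Y => //; rewrite setTI.
Qed.

Lemma measurable_fun_rowP d d1 (T : measurableType d) (U : measurableType d1) n
    (f : U -> 'rV[T]_n) :
  (forall i, measurable_fun [set: U] (fun x => f x ord0 i)) ->
  measurable_fun [set: U] f.
Proof.
move=> mf _ Y; rewrite setTI; move: Y.
apply: smallest_sub => /=.
  split => /=.
  - by rewrite preimage_set0.
  - by move=> A mA; rewrite setTD preimage_setC; exact: measurableC.
  - by move=> F mF; rewrite preimage_bigcup; exact: bigcup_measurable.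
move=> A; rewrite -bigcup_seq/= => -[i _ [B mB <-]].
by rewrite setTI; have := mf i measurableT B mB; rewrite setTI.
Qed.

Section lebesgue_step.
Context {R : realType}.
Variable n : nat.

Definition row_cons (xv : measurableTypeR R * 'rV[R]_n) : 'rV[R]_n.+1 :=
  row_mx (const_mx xv.1 : 'rV_1) xv.2.

Definition row_uncons (v : 'rV[R]_n.+1) : measurableTypeR R * 'rV[R]_n :=
  (v ord0 ord0, \row_i v ord0 (lift ord0 i)).

Lemma row_cons0 xv : row_cons xv ord0 ord0 = xv.1.
Proof.
have := row_mxEl (const_mx xv.1 : 'rV[R]_1) xv.2 ord0 ord0.
by rewrite [RHS]mxE => <-; congr (row_mx _ _ _ _); exact: val_inj.
Qed.

Lemma row_consS xv i : row_cons xv ord0 (lift ord0 i) = xv.2 ord0 i.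
Proof.
rewrite -(row_mxEr (const_mx xv.1 : 'rV[R]_1) xv.2 ord0 i).
by congr (row_mx _ _ _ _); exact: val_inj.
Qed.

Lemma row_consK : cancel row_cons row_uncons.
Proof.
move=> -[x v]; rewrite /row_uncons row_cons0; congr pair.
by apply/rowP => i; rewrite mxE row_consS.
Qed.

Lemma row_unconsK : cancel row_uncons row_cons.
Proof.
move=> v; apply/rowP => i; case: (unliftP ord0 i) => [j|] ->.
  by rewrite row_consS mxE.
by rewrite row_cons0.
Qed.

Lemma measurable_row_cons : measurable_fun [set: _] row_cons.
Proof.
apply: measurable_fun_rowP => i; case: (unliftP ord0 i) => [j|] ->.
  under eq_fun do rewrite row_consS.
  exact: (measurableT_comp (measurable_coor j) measurable_snd).
under eq_fun do rewrite row_cons0.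
exact: measurable_fst.
Qed.

Lemma measurable_row_uncons : measurable_fun [set: _] row_uncons.
Proof.
apply/measurable_fun_pairP; split => /=.
  exact: measurable_coor.
apply: measurable_fun_rowP => i /=.
under eq_fun do rewrite mxE.
exact: measurable_coor.
Qed.

Variable mu : {sigma_finite_measure set 'rV[R]_n -> \bar R}.

Definition lebesgue_step : set 'rV[R]_n.+1 -> \bar R :=
  pushforward (lebesgue_measure \x mu)%E row_cons.

Let measurable_preim A : measurable A -> measurable (row_cons @^-1` A).
Proof.
by move=> mA; rewrite -[X in measurable X]setTI; exact: measurable_row_cons.
Qed.

Let step0 : lebesgue_step set0 = 0%E.
Proof. by rewrite /lebesgue_step /pushforward preimage_set0 measure0. Qed.

Let step_ge0 A : (0 <= lebesgue_step A)%E.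
Proof. rewrite /lebesgue_step /pushforward; exact: measure_ge0. Qed.

Let step_sigma_additive : semi_sigma_additive lebesgue_step.
Proof.
move=> F mF tF mUF; rewrite /lebesgue_step /pushforward preimage_bigcup.
apply: measure_semi_sigma_additive.
- by move=> i; exact: measurable_preim.
- apply/trivIsetP => /= i j _ _ ij; rewrite -preimage_setI.
  by move/trivIsetP : tF => /(_ _ _ _ _ ij) ->//; rewrite preimage_set0.
- by rewrite -preimage_bigcup; exact: measurable_preim.
Qed.

HB.instance Definition _ := isMeasure.Build _ _ _ lebesgue_step
  step0 step_ge0 step_sigma_additive.

Let step_sigma_finite : sigma_finite setT lebesgue_step.
Proof.
have /sigma_finiteP[F [TF ndF Foo]] := sigma_finiteT (@lebesgue_measure R).
have /sigma_finiteP[G [TG ndG Goo]] := sigma_finiteT mu.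
exists (fun k => row_uncons @^-1` (F k `*` G k)) => [|k].
  rewrite -preimage_bigcup (_ : \bigcup_i _ = setT) ?preimage_setT//.
  rewrite -setXTT TF TG predeqE => -[x y]; split.
    by move=> [i _ []/= ? ?]; split; exists i.
  move=> [/= [i _ Fix] [k _ Gky]]; exists (maxn i k) => //; split.
  - by move: x Fix; exact/subsetPset/ndF/leq_maxl.
  - by move: y Gky; exact/subsetPset/ndG/leq_maxr.
have [? ?] := Foo k; have [? ?] := Goo k; split.
  rewrite -[X in measurable X]setTI; apply: measurable_row_uncons => //.
  exact: measurableX.
rewrite /lebesgue_step /pushforward -comp_preimage.
rewrite (_ : row_uncons \o row_cons = id); last first.
  by apply/funext => ?; exact: row_consK.
by rewrite preimage_id product_measure1E// lte_mul_pinfty// ge0_fin_numE.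
Qed.

HB.instance Definition _ := Measure_isSigmaFinite.Build _ _ _ lebesgue_step
  step_sigma_finite.

End lebesgue_step.

Section lebesgue_measure_row.
Variable R : realType.

(* Lebesgue measure on R^n: the n-fold product of the Lebesgue measure on R
   (see lebesgue_row_box for its value on boxes). *)
Fixpoint lebesgue_row n : {sigma_finite_measure set 'rV[R]_n -> \bar R} :=
  match n with
  | 0 => dirac (0 : 'rV[R]_0)
  | m.+1 => lebesgue_step (lebesgue_row m)
  end.

Lemma lebesgue_row_box n (a b : 'rV[R]_n) :
  (forall i, a ord0 i <= b ord0 i) ->
  lebesgue_row n
    [set x : 'rV[R]_n | forall i, x ord0 i \in `[a ord0 i, b ord0 i]] =
  (\prod_i (b ord0 i - a ord0 i))%:E.
Proof.
elim: n a b => [a b _|n IH a b ab].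
  rewrite /= big_ord0 diracE mem_set//= => -[]//.
pose tl (v : 'rV[R]_n.+1) := \row_i v ord0 (lift ord0 i) : 'rV[R]_n.
transitivity ((lebesgue_measure \x lebesgue_row n)%E
    (`[a ord0 ord0, b ord0 ord0]%classic `*`
     [set x : 'rV[R]_n | forall i, x ord0 i \in `[tl a ord0 i, tl b ord0 i]])).
  congr ((_ \x _)%E _).
  apply/seteqP; split => -[x v] /=.
    move=> h; split; first by have := h ord0; rewrite row_cons0.
    by move=> i; have := h (lift ord0 i); rewrite row_consS !mxE.
  move=> [hx hv] i; case: (unliftP ord0 i) => [j|] ->; last by rewrite row_cons0.
  by have := hv j; rewrite row_consS !mxE.
rewrite product_measure1E//; last first.
  rewrite (_ : [set _ | _] = \bigcap_(i in [set: 'I_n])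
    ((fun x : 'rV[R]_n => x ord0 i) @^-1` `[tl a ord0 i, tl b ord0 i]%classic)).
    apply: fin_bigcap_measurable => //= i _.
    by rewrite -[X in measurable X]setTI; exact: measurable_coor.
  by apply/seteqP; split => x /= h i //; [move=> _; exact: h|exact: h].
rewrite IH; last by move=> i; rewrite !mxE.
rewrite big_ord_recl EFinM; congr mule; last first.
  by congr EFin; apply: eq_bigr => i _; rewrite !mxE.
apply: (etrans (lebesgue_measure_itv _)); rewrite /= lte_fin.
by case: ltgtP (ab ord0) => // -> _; rewrite subrr.
Qed.

End lebesgue_measure_row.

Section balls.
Context {R : realType} {n : nat}.
Implicit Types (Omega B : set 'rV[R]_n) (f : 'rV[R]_n -> R).

Definition domain Omega := [/\ open Omega, connected Omega & Omega !=set0].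

(* The library norm on row vectors is the sup norm. *)
Definition euclidean_norm (x : 'rV[R]_n) : R :=
  Num.sqrt (\sum_i x ord0 i ^+ 2).

Definition nball : set (set 'rV[R]_n) :=
  [set B | exists c r, 0 < r /\ B = [set x | euclidean_norm (x - c) <= r]].

Definition nballs_in Omega : set (set 'rV[R]_n) :=
  [set B | nball B /\ B `<=` Omega].

Definition vol B : R := fine (lebesgue_row R n B).

Definition integral_on B f : R := \int[lebesgue_row R n]_(x in B) f x.

Definition average_norm Omega f : \bar R :=
  ereal_sup [set ((vol B)^-1 * `|integral_on B f|)%:E | B in nballs_in Omega].

End balls.

Section finite_dimension.
Context {R : realType} {V : lmodType R}.

Definition is_basis (S : set V) N (b : 'I_N -> V) :=
  (forall i, S (b i)) /\
  (forall v, S v -> exists! c : 'rV[R]_N, v = \sum_i c ord0 i *: b i).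

Definition has_dim (S : set V) N := exists b : 'I_N -> V, is_basis S b.

End finite_dimension.

Section polynomials.
Context {R : realType} {n : nat}.

(* msize p is the total degree of p plus one, and 0 for p = 0. *)
Definition poly_le (d : nat) : set (mpoly n R) :=
  [set p | (msize p <= d.+1)%N].

Definition peval (p : mpoly n R) (x : 'rV[R]_n) : R := meval (x ord0) p.

Definition unisolvent d N (B : 'I_N -> set 'rV[R]_n) :=
  forall p, poly_le d p ->
    (forall i, integral_on (B i) (peval p) = 0) -> p = 0.

Definition lagrange_basis d N (B : 'I_N -> set 'rV[R]_n)
    (ell : 'I_N -> mpoly n R) :=
  is_basis (poly_le d) ell /\
  forall i j, integral_on (B j) (peval (ell i)) = (i == j)%:R.

Definition interpolation N (B : 'I_N -> set 'rV[R]_n)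
    (ell : 'I_N -> mpoly n R) (f : 'rV[R]_n -> R) : mpoly n R :=
  \sum_i integral_on (B i) f *: ell i.

(* May be +oo, e.g. when Omega is unbounded. *)
Definition op_norm (Omega : set 'rV[R]_n)
    (T : ('rV[R]_n -> R) -> mpoly n R) : \bar R :=
  ereal_sup [set (average_norm Omega (peval (T f)) / average_norm Omega f)%E |
    f in [set f | continuous f /\ (0 < average_norm Omega f < +oo)%E]].

End polynomials.

(* Main.v *)
Require Import Defs.
From HB Require Import structures.
From mathcomp Require Import all_boot all_order all_algebra.
From mathcomp Require Import -(notations) mpoly.
From mathcomp Require Import all_classical all_reals all_analysis.
From mathcomp Require Import measurable_realfun.
Set Implicit Arguments.
Unset Strict Implicit.
Unset Printing Implicit Defensive.
Import Order.TTheory GRing.Theory Num.Theory.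
Import numFieldNormedType.Exports.
Local Open Scope classical_set_scope.
Local Open Scope ring_scope.

(* Upper bound: |B_i|^-1 |int_{B_i} f| <= ||f||_B for every i, by definition of
   ||.||_B, since B_i is itself a ball of Omega.
   Lower bound: the B_i being closed and pairwise disjoint, for each ball B' of
   Omega there is a continuous f with |f| <= 1 which on every B_i is constantly
   the sign of int_{B'} l_i; then ||f||_B = 1 and
   int_{B'} (Pi f) = sum_i |B_i| |int_{B'} l_i|. *)

(** * Measure and integration on Euclidean balls *)

Section balls.
Context {R : realType} {n : nat}.
Implicit Types (c x : 'rV[R]_n) (B : set 'rV[R]_n) (f : 'rV[R]_n -> R).

(** The square of [euclidean_norm (x - c)]: without the root it is polynomial in the coordinates,
    which gives measurability and continuity at once. *)
Definition sqdist c x : R := \sum_i (x ord0 i - c ord0 i) ^+ 2.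

Lemma nball_sqdist B : nball B ->
  exists c r, 0 < r /\ B = [set x | sqdist c x <= r ^+ 2].
Proof.
move=> [c [r [r0 ->]]]; exists c, r; split => //.
have sqE x : \sum_i (x - c) ord0 i ^+ 2 = sqdist c x.
  by apply: eq_bigr => i _; rewrite !mxE.
have sq_ge0 x : 0 <= sqdist c x by apply: sumr_ge0 => i _; exact: sqr_ge0.
apply/seteqP; split => x; rewrite /= /euclidean_norm sqE => h.
  by rewrite -(sqr_sqrtr (sq_ge0 x)) lerXn2r// ?nnegrE ?sqrtr_ge0// ltW.
by rewrite -(ger0_norm (ltW r0)) -sqrtr_sqr ler_wsqrtr.
Qed.

Lemma measurable_sqdist c : measurable_fun [set: 'rV[R]_n] (sqdist c).
Proof.
apply: measurable_sum => i; apply: measurable_funX.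
by apply: measurable_funB => //; exact: measurable_coor.
Qed.

Lemma continuous_sqdist c : continuous (sqdist c).
Proof.
apply: continuous_big; first exact: add_continuous.
move=> i _ x; have cx := @coord_continuous R 1 n ord0 i x.
have cB : {for x, continuous (fun x : 'rV[R]_n => x ord0 i - c ord0 i)}.
  by apply: continuousB => //; exact: cst_continuous.
exact: (continuousM cB cB).
Qed.

Lemma measurable_nball B : nball B -> measurable B.
Proof.
move=> /nball_sqdist[c [r [_ ->]]].
have := @measurable_sqdist c measurableT `]-oo, r ^+ 2]%classic.
rewrite setTI; apply.
exact: measurable_itv.
Qed.

Lemma sqdist_coord c x r i : 0 < r -> sqdist c x <= r ^+ 2 ->
  `|x ord0 i - c ord0 i| <= r.
Proof.
move=> /ltW r0 xr; rewrite -ler_sqr ?nnegrE// real_normK ?num_real//.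
apply: le_trans xr; rewrite /sqdist (bigD1 i)//= lerDl.
by apply: sumr_ge0 => j _; exact: sqr_ge0.
Qed.

Lemma nball_bounded B : nball B ->
  exists2 M, 0 < M & forall x, B x -> forall i, `|x ord0 i| <= M.
Proof.
move=> /nball_sqdist[c [r [r0 ->]]].
exists (r + \sum_i `|c ord0 i|).
  by rewrite ltr_wpDr// sumr_ge0.
move=> x /= xr i; rewrite -[x _ _](subrK (c ord0 i)) (le_trans (ler_normD _ _))//.
rewrite lerD ?sqdist_coord// (bigD1 i)//= lerDl sumr_ge0//.
Qed.

Lemma lebesgue_row_cube c (r : R) : 0 <= r ->
  lebesgue_row R n [set x | forall i, `|x ord0 i - c ord0 i| <= r] =
  ((r *+ 2) ^+ n)%:E.
Proof.
move=> r0; pose a := c - const_mx r; pose b := c + const_mx r.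
have ab i : b ord0 i - a ord0 i = r *+ 2.
  by rewrite !mxE opprD opprK addrACA subrr add0r.
transitivity (lebesgue_row R n
    [set x : 'rV[R]_n | forall i, x ord0 i \in `[a ord0 i, b ord0 i]]).
  congr (lebesgue_row R n _); apply/seteqP; split => x /= h i; have := h i;
    by rewrite in_itv/= !mxE ler_distl.
rewrite lebesgue_row_box; last by move=> i; rewrite -subr_ge0 ab mulrn_wge0.
by under eq_bigr do rewrite ab; rewrite prodr_const card_ord.
Qed.

Lemma measurable_cube c (r : R) :
  measurable [set x : 'rV[R]_n | forall i, `|x ord0 i - c ord0 i| <= r].
Proof.
rewrite (_ : [set _ | _] = \bigcap_(i in [set: 'I_n])
    ((fun x : 'rV[R]_n => x ord0 i) @^-1` `[c ord0 i - r, c ord0 i + r]%classic)).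
  apply: fin_bigcap_measurable => //= i _.
  by rewrite -[X in measurable X]setTI; exact: measurable_coor.
by apply/seteqP; split => x /= h i => [_|]; [have := h i|have := h i I];
  rewrite /= in_itv/= ler_distl.
Qed.

(** A ball of radius [r] lies between two concentric cubes, of half-sides [r / n.+1] and [r], whose
    measures are known. Finiteness ensures that [fine] loses nothing in [vol]. *)
Lemma lebesgue_row_nball B : nball B -> (0 < lebesgue_row R n B < +oo)%E.
Proof.
move=> nB; have mB := measurable_nball nB.
have [c [r [r0 EB]]] := nball_sqdist nB; apply/andP; split.
  (* On the cube of half-side [s], [sqdist] is at most [n * s ^+ 2], which is at most [r ^+ 2].
     Dividing by [n.+1] avoids a square root and a zero divisor when [n = 0]. *)
  pose s := r / n.+1%:R.
  have s0 : 0 < s by rewrite divr_gt0.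
  apply: (@lt_le_trans _ _ ((s *+ 2) ^+ n)%:E).
    by rewrite lte_fin exprn_gt0// mulrn_wgt0.
  rewrite -(lebesgue_row_cube c (ltW s0)); apply: le_measure;
    rewrite ?inE//; first exact: measurable_cube.
  rewrite EB => x /= xs.
  apply: (@le_trans _ _ (\sum_(i < n) s ^+ 2)).
    apply: ler_sum => i _; rewrite -real_normK ?num_real//.
    by rewrite lerXn2r// ?nnegrE// ltW.
  rewrite sumr_const card_ord -mulr_natr /s expr_div_n -mulrA ler_piMr ?sqr_ge0//.
  rewrite mulrC ler_pdivrMr ?exprn_gt0// mul1r -natrX ler_nat.
  by rewrite (leq_trans (leqnSn n))// leq_pmulr.
apply: (@le_lt_trans _ _ ((r *+ 2) ^+ n)%:E); last exact: ltry.
rewrite -(lebesgue_row_cube c (ltW r0)); apply: le_measure;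
  rewrite ?inE//; first exact: measurable_cube.
by rewrite EB => x /= xr i; exact: sqdist_coord.
Qed.

Lemma vol_nball_gt0 B : nball B -> 0 < vol B.
Proof. by move=> nB; rewrite fine_gt0// lebesgue_row_nball. Qed.

Lemma integrable_nball B f M : nball B -> measurable_fun [set: 'rV[R]_n] f ->
  (forall x, B x -> `|f x| <= M) ->
  (lebesgue_row R n).-integrable B (EFin \o f).
Proof.
move=> nB mf fM; apply: measurable_bounded_integrable.
- exact: measurable_nball.
- by have /andP[] := lebesgue_row_nball nB.
- exact: measurable_funTS.
- exists M; split; first exact: num_real.
  by move=> A MA x Bx; exact: le_trans (fM x Bx) (ltW MA).
Qed.

Lemma integral_on_cst B k : nball B -> integral_on B (fun=> k) = k * vol B.
Proof. by move=> nB; rewrite /integral_on Rintegral_cst//; exact: measurable_nball. Qed.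

Lemma integral_on_le B f : nball B -> measurable_fun [set: 'rV[R]_n] f ->
  (forall x, `|f x| <= 1) -> `|integral_on B f| <= vol B.
Proof.
move=> nB mf f1; have mB := measurable_nball nB.
have intf : (lebesgue_row R n).-integrable B (EFin \o f).
  by apply: (@integrable_nball _ _ 1).
rewrite (le_trans (le_normr_Rintegral mB intf))//.
rewrite -[leRHS]mul1r -integral_on_cst//.
apply: le_Rintegral => //.
- apply: (@integrable_nball _ _ 1) => //; first exact: measurableT_comp.
  by move=> x _; rewrite normr_id.
- by apply: (@integrable_nball _ _ 1) => // x _; rewrite normr1.
Qed.

(** All coordinates are bounded by some [M] on a ball, so the triangle inequality over the monomials
    bounds [p] there. *)
Lemma integrable_peval B (p : mpoly n R) : nball B ->
  (lebesgue_row R n).-integrable B (EFin \o peval p).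
Proof.
move=> nB; have [M M0 BM] := nball_bounded nB.
have pE : peval p = fun x => \sum_(m <- msupp p) mcoeff m p * \prod_i x ord0 i ^+ m i.
  by apply/funext => x; exact: mevalE.
apply: (@integrable_nball _ _ (\sum_(m <- msupp p) `|mcoeff m p| * \prod_i M ^+ m i)) => //.
  rewrite pE; apply: measurable_sum => m; apply: measurable_funM => //.
  by apply: measurable_prod => i _; apply: measurable_funX; exact: measurable_coor.
move=> x Bx; rewrite pE (le_trans (ler_norm_sum _ _ _))//.
apply: ler_sum => m _; rewrite normrM ler_wpM2l// normr_prod.
apply: ler_prod => i _; rewrite normr_ge0 normrX lerXn2r ?nnegrE ?(ltW M0)//.
exact: BM.
Qed.

(** Linearity of the integral, available because polynomials are integrable on balls; it expands the
    integral of an interpolant over any ball. *)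
Lemma integral_on_peval_sum B I (s : seq I) (a : I -> R) (p : I -> mpoly n R) :
  nball B ->
  integral_on B (peval (\sum_(i <- s) a i *: p i)) =
  \sum_(i <- s) a i * integral_on B (peval (p i)).
Proof.
move=> nB; have mB := measurable_nball nB.
elim: s => [|i s IH].
  rewrite !big_nil -(mul0r (vol B)) -integral_on_cst//.
  by congr integral_on; apply/funext => x; exact: meval0.
rewrite !big_cons -IH /integral_on -RintegralZl//; last exact: integrable_peval.
rewrite -RintegralD//; last 2 first.
- rewrite (_ : _ \o _ = EFin \o peval (a i *: p i)); first exact: integrable_peval.
  by apply/funext => x /=; rewrite -mevalZ.
- exact: integrable_peval.
by congr Rintegral; apply/funext => x; rewrite /peval mevalD mevalZ.
Qed.

End balls.

(** * Continuous functions with prescribed constants on disjoint balls *)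

Section separation.
Context {R : realType} {n : nat}.
Implicit Types B : set 'rV[R]_n.

Lemma nball_gauge B : nball B -> exists g : 'rV[R]_n -> R,
  [/\ continuous g, measurable_fun [set: 'rV[R]_n] g,
      forall x, 0 <= g x & forall x, g x = 0 <-> B x].
Proof.
move=> /nball_sqdist[c [r [_ ->]]]; pose t x := sqdist c x - r ^+ 2.
have mt : measurable_fun [set: 'rV[R]_n] t.
  by apply: measurable_funB => //; exact: measurable_sqdist.
have ct : continuous t.
  move=> x; apply: continuousB; last exact: cst_continuous.
  exact: continuous_sqdist.
(* This is twice the positive part of [t], so it vanishes exactly where [t x <= 0], that is, on the
   ball. *)
exists (fun x => `|t x| + t x); split => [|||x].
- move=> x; have cn : {for x, continuous (fun y => `|t y|)}.
    by apply: continuous_comp; [exact: ct|exact: norm_continuous].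
  exact: (continuousD cn (ct x)).
- by apply: measurable_funD => //; exact: measurableT_comp.
- by move=> x; rewrite -lerBlDr sub0r -normrN ler_norm.
- split => /= [/eqP|tx]; last by rewrite ler0_norm ?subr_le0// addNr.
  by rewrite addr_eq0 => /eqP h; rewrite -subr_le0 -oppr_ge0 -/(t x) -h.
Qed.

(* If [g i] is a nonnegative function vanishing exactly on [B i], then
   [w i = \prod_(j != i) g j] is positive on [B i] and vanishes on the other
   balls, so the average of the [s i] with weights [w i] is [s i] on [B i]. *)
Lemma nball_separation N (B : 'I_N -> set 'rV[R]_n) (s : 'I_N -> R) :
  'I_N -> (forall i, nball (B i)) ->
  (forall i j, i != j -> B i `&` B j = set0) ->
  (forall i, `|s i| <= 1) ->
  exists f : 'rV[R]_n -> R,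
    [/\ continuous f, measurable_fun [set: 'rV[R]_n] f,
        forall x, `|f x| <= 1 & forall i x, B i x -> f x = s i].
Proof.
move=> i0 nB dB s1.
have /choice[g gP] i := nball_gauge (nB i).
pose w i x := \prod_(j | j != i) g j x.
pose W x := \sum_i w i x.
have w_ge0 i x : 0 <= w i x by apply: prodr_ge0 => j _; have [] := gP j.
have w_gt0 i x : (forall j, j != i -> ~ B j x) -> 0 < w i x.
  move=> h; apply: prodr_gt0 => j ji; have [_ _ g0 gB] := gP j.
  by rewrite lt_neqAle g0 andbT eq_sym; apply/eqP => /gB; exact: h.
have wB i x : B i x -> 0 < w i x.
  move=> Bx; apply: w_gt0 => j ji Bj.
  by have : (B j `&` B i) x by []; rewrite dB.
have wB0 i j x : B i x -> j != i -> w j x = 0.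
  move=> Bx ji; rewrite /w (bigD1 i) 1?eq_sym//=.
  by have [_ _ _ /(_ x)[_ ->//]] := gP i; rewrite mul0r.
(* On a ball its own weight is positive; off all the balls every weight is, and [i0] guarantees that
   there is one. *)
have W_gt0 x : 0 < W x.
  have [[i Bx]|nBx] := pselect (exists i, B i x).
    by rewrite /W (bigD1 i)//= ltr_wpDr ?wB// sumr_ge0.
  rewrite /W (bigD1 i0)//= ltr_wpDr ?sumr_ge0// w_gt0// => j _ Bx.
  by apply: nBx; exists j.
have cw i : continuous (w i).
  apply: continuous_big; first exact: mul_continuous.
  by move=> j _; have [] := gP j.
have cW : continuous W by apply: continuous_big => //; exact: add_continuous.
have mw i : measurable_fun [set: 'rV[R]_n] (w i).
  (* Filtering the index list turns the conditional product into the unconditional form that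
     [measurable_prod] handles. *)
  rewrite (_ : w i = fun x => \prod_(j <- [seq j <- index_enum 'I_N | j != i]) g j x).
    by apply: measurable_prod => j _; have [] := gP j.
  by apply/funext => x; rewrite big_filter.
have mW : measurable_fun [set: 'rV[R]_n] W by exact: measurable_sum.
exists (fun x => (\sum_i s i * w i x) * (W x)^-1); split.
- have cn : continuous (fun x => \sum_i s i * w i x).
    apply: continuous_big; first exact: add_continuous.
    move=> i _ x; have cs : {for x, continuous (fun=> s i)} by exact: cst_continuous.
    exact: (continuousM cs (cw i x)).
  move=> x; have W0 := lt0r_neq0 (W_gt0 x).
  exact: (continuousM (cn x) (continuousV W0 (cW x))).
(* The inverse is written as a real power to use [measurable_powR]; the two agree because [W] is
   positive. *)
- rewrite (_ : (fun x => _) = fun x => (\sum_i s i * w i x) * W x `^ (-1)).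
    apply: measurable_funM.
      by apply: measurable_sum => i; exact: measurable_funM.
    exact: (measurableT_comp (measurable_powR (-1)) mW).
  by apply/funext => x; rewrite powR_inv1// ltW.
- move=> x; rewrite normrM normfV (gtr0_norm (W_gt0 x)) ler_pdivrMr// mul1r.
  rewrite (le_trans (ler_norm_sum _ _ _))//; apply: ler_sum => i _.
  by rewrite normrM (ger0_norm (w_ge0 i x)) ler_piMl.
- move=> i x Bx; rewrite /W (bigD1 i)//= big1 ?addr0; last first.
    by move=> j ji; rewrite (wB0 i)// mulr0.
  rewrite (bigD1 i)//= big1 ?addr0; last by move=> j ji; exact: (wB0 i).
  by rewrite mulfK// lt0r_neq0// wB.
Qed.

End separation.

(** * The two inequalities for the operator norm *)

Theorem theorem3p4 (R : realType) (n d N : nat) (Omega : set 'rV[R]_n)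
    (B : 'I_N -> set 'rV[R]_n) (ell : 'I_N -> mpoly n R) :
  domain Omega ->
  has_dim (@poly_le R n d) N ->
  (forall i, nballs_in Omega (B i)) ->
  unisolvent d B ->
  lagrange_basis d B ell ->
  (forall i j, i != j -> B i `&` B j = set0) ->
  op_norm Omega (interpolation B ell) =
  ereal_sup [set ((vol B')^-1 *
      \sum_i vol (B i) * `|integral_on B' (peval (ell i))|)%:E
    | B' in nballs_in Omega].
Proof.
move=> _ [b [_ b_gen]] BO _ _ dB.
have nB i : nball (B i) by have [] := BO i.
(* The dimension is positive: the constant [1] is a nonzero element of [poly_le d], while an empty
   family generates only [0]. *)
have i0 : 'I_N.
  case: N {B ell BO dB nB} b b_gen => [|N] b b_gen; last exact: ord0.
  exfalso; have [|c [/eqP + _]] := b_gen 1; first by rewrite /poly_le/= msize1.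
  by rewrite big_ord0 oner_eq0.
have integral_interpolation f B' : nball B' ->
    integral_on B' (peval (interpolation B ell f)) =
    \sum_i integral_on (B i) f * integral_on B' (peval (ell i)).
  exact: integral_on_peval_sum.
apply/eqP; rewrite eq_le; apply/andP; split.
  apply: ge_ereal_sup => _ [f [_ /andP[f_gt0 f_lty]] <-].
  have : average_norm Omega f \is a fin_num by rewrite ge0_fin_numE// ltW.
  case E : (average_norm Omega f) f_gt0 => [a| |]// + _; rewrite lte_fin => a0.
  have fB i : `|integral_on (B i) f| <= a * vol (B i).
    rewrite mulrC -ler_pdivrMl ?vol_nball_gt0// -lee_fin -E.
    by apply: ereal_sup_ubound; exists (B i).
  rewrite inver gt_eqF// lee_pdivrMr//.
  apply: ge_ereal_sup => _ [B' B'O <-]; have [nB' _] := B'O.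
  (* The comparison is made ball by ball, with the factor [a], before passing to the supremum, which
     may be infinite. *)
  apply: (@le_trans _ _ (((vol B')^-1 *
      \sum_i vol (B i) * `|integral_on B' (peval (ell i))|)%:E * a%:E)%E).
    rewrite -EFinM lee_fin -mulrA ler_wpM2l ?invr_ge0 ?(ltW (vol_nball_gt0 nB'))//.
    rewrite integral_interpolation// (le_trans (ler_norm_sum _ _ _))//.
    rewrite mulr_suml; apply: ler_sum => i _.
    by rewrite normrM mulrAC ler_wpM2r// mulrC.
  apply: lee_wpmul2r; first by rewrite lee_fin ltW.
  by apply: ereal_sup_ubound; exists B'.
apply: ge_ereal_sup => _ [B' B'O <-]; have [nB' _] := B'O.
(* The sign is [1] when the integral vanishes, never [0], so that [f] has absolute value [1] on
   every [B i]. *)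
pose s i : R := (-1) ^+ (integral_on B' (peval (ell i)) < 0)%R.
have [|f [cf mf f1 fB]] := nball_separation (s := s) i0 nB dB.
  by move=> i; rewrite normr_sign.
have intf i : integral_on (B i) f = s i * vol (B i).
  rewrite -integral_on_cst//; apply: eq_Rintegral => x.
  by rewrite inE; exact: fB.
have f_norm : average_norm Omega f = 1%E.
  apply/eqP; rewrite eq_le; apply/andP; split.
    apply: ge_ereal_sup => _ [C [nC _] <-].
    by rewrite lee_fin ler_pdivrMl ?vol_nball_gt0// mulr1 integral_on_le.
  (* The value [1] is attained on [B i0], where [f] is constantly [1] or [-1]. *)
  apply: ereal_sup_ubound; exists (B i0) => //.
  have v0 := vol_nball_gt0 (nB i0).
  by rewrite intf normrM normr_sign mul1r gtr0_norm// mulVf// gt_eqF.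
apply: (@le_trans _ _ (average_norm Omega (peval (interpolation B ell f)))).
  apply: ereal_sup_ubound; exists B' => //.
  rewrite integral_interpolation//; congr (_ * _)%:E.
  (* Each sign turns its integral into an absolute value; the sum is then nonnegative and the outer
     absolute value disappears. *)
  under eq_bigr do rewrite intf mulrAC -normrEsign mulrC.
  by rewrite ger0_norm// sumr_ge0// => i _; rewrite mulr_ge0// ltW ?vol_nball_gt0.
(* As [f] has norm [1], the norm of its interpolant is itself one of the quotients defining
   [op_norm]. *)
apply: ereal_sup_ubound; exists f; first by split => //; rewrite f_norm lte01 ltry.
by rewrite f_norm inve1 mule1.
Qed.
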